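(* Let $N\geq1$. The magic representation $w$ of $\bar{O}_N$ (the one giving the embedding $\bar O_N\subset S_{2^N}^+$) corresponds to the antisymmetric representation $\bigoplus_{r=0}^N X_r$ of $O_N$, via the twisting correspondence between the representations of $O_N$ and those of $\bar O_N$.
   Context: $\bar O_N$ is the compact quantum group whose algebra $C(\bar O_N)$ is the universal $C^*$-algebra generated by self-adjoint elements $\bar u_{ij}$ ($1\le i,j\le N$) such that $\bar u=(\bar u_{ij})$ satisfies $\bar u^t=\bar u^{-1}$, and such that distinct entries $\bar u_{ij},\bar u_{kl}$ anticommute if they lie on the same row or the same column and commute otherwise; its comultiplication is $\Delta(\bar u_{ij})=\sum_k \bar u_{ik}\otimes \bar u_{kj}$. Magic representation. Let $g_1,\ldots,g_N$ be the standard generators of $\mathbb Z_2^N$. There is a coaction $\Phi:C^*(\mathbb Z_2^N)\to C(\bar O_N)\otimes C^*(\mathbb Z_2^N)$, $\Phi(g_i)=\sum_j \bar u_{ij}\otimes g_j$ (the quantum isometric action of $\bar O_N$ on the $N$-hypercube). One identifies $C^*(\mathbb Z_2^N)$ with $C(\mathbb Z_2^N)$ via the Fourier isomorphism $\beta(g_1^{i_1}\cdots g_N^{i_N})=\sum_{j\in\{0,1\}^N}(-1)^{\langle i,j\rangle}\delta_{g_1^{j_1}\cdots g_N^{j_N}}$. The magic representation $w=(w_{i,k})_{i,k\in\{0,1\}^N}$ is the matrix of the resulting coaction $\Psi=(id\otimes\beta)\Phi\beta^{-1}$, that is, $\Psi(\delta_{g_1^{i_1}\cdots g_N^{i_N}})=\sum_{k}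 w_{i,k}\otimes\delta_{g_1^{k_1}\cdots g_N^{k_N}}$. Antisymmetric representation. For $0\le r\le N$, $X_r\subset(\mathbb C^N)^{\otimes r}$ is the $O_N$-invariant subspace of antisymmetric tensors, spanned by $\xi_{i_1\ldots i_r}=\sum_{\sigma\in S_r}\varepsilon(\sigma)e_{i_{\sigma(1)}}\otimes\cdots\otimes e_{i_{\sigma(r)}}$, with $i_1<\cdots<i_r$, where $\varepsilon$ is the signature and $(e_i)$ is the standard basis of $\mathbb C^N$. The antisymmetric representation of $O_N$ is $\bigoplus_{r=0}^NX_r$. Twisting correspondence. Let $\mathcal O(O_N)$ and $\mathcal O(\bar O_N)$ be the Hopf $*$-algebras generated by the standard coordinates $u_{ij}$ and $\bar u_{ij}$. Let $s(i,k)=-1$ if $i<k$ and $s(i,k)=1$ if $i\ge k$. Then $\mathcal O(\bar O_N)$ is the $2$-cocycle twist of $\mathcal O(O_N)$ along the diagonal subgroup $\mathbb Z_2^N\subset O_N$, for the bicharacter on the dual of this subgroup with values $s(i,k)$ on the coordinate characters: there is a coalgebra isomorphism $\mathcal O(O_N)\to\mathcal O(\bar O_N)$ such that, for all indices, $\left(\prod_{x<y}s(i_x,i_y)s(j_x,j_y)\right)u_{i_1j_1}\cdots u_{i_mj_m}\mapsto\bar u_{i_1j_1}\cdots\bar u_{i_mj_m}$. Via this coalgebra isomorphism, the finite dimensional representations (corepresentations) of $O_N$ correspond to those of $\bar O_N$, the irreducible ones corresponding to irreducible ones, with the same fusion rules, and the fundamental representation $u$ corresponding to $\bar u$. Representations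 are considered up to equivalence. *)

(* Defs.v *)
From HB Require Import structures.
From mathcomp Require Import all_boot all_order all_algebra all_fingroup.
From mathcomp Require Import sesquilinear.
From mathcomp Require Import boolp classical_sets functions reals topology.
From mathcomp Require Import complex.
Set Implicit Arguments.
Unset Strict Implicit.
Unset Printing Implicit Defensive.
Import Order.TTheory GRing.Theory Num.Theory.

Local Open Scope classical_set_scope.
Local Open Scope ring_scope.
Local Open Scope complex_scope.

HB.mixin Record isStarAlgebra (R : realType) A of GRing.Algebra R[i] A := {
  star : A -> A;
  starD : forall x y, star (x + y) = star x + star y;
  starZ : forall (c : R[i]) x, star (c *: x) = c^* *: star x;
  starM : forall x y, star (x * y) = star y * star x;
  starK : involutive star
}.

#[short(type="starAlgType")]
HB.structure Definition StarAlgebra (R : realType) :=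
  {A of GRing.Algebra R[i] A & isStarAlgebra R A}.

HB.mixin Record isCStarAlgebra (R : realType) A of StarAlgebra R A := {
  cnorm : A -> R;
  cnormD : forall x y, cnorm (x + y) <= cnorm x + cnorm y;
  cnormZ : forall (c : R[i]) x, (cnorm (c *: x))%:C = `|c| * (cnorm x)%:C;
  cnorm0_eq0 : forall x, cnorm x = 0 -> x = 0;
  cnormM : forall x y, cnorm (x * y) <= cnorm x * cnorm y;
  cnorm_starM : forall x, cnorm (star x * x) = cnorm x ^+ 2;
  cnorm_complete : forall a : nat -> A,
    (forall e, 0 < e -> exists n0, forall m n, (n0 <= m)%N -> (n0 <= n)%N ->
      cnorm (a m - a n) < e) ->
    exists l, forall e, 0 < e -> exists n0, forall n, (n0 <= n)%N ->
      cnorm (a n - l) < e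
}.

(* Algebras are nonzero in this library; as the zero algebra has a single
   morphism from any algebra, universal properties are not affected. *)
#[short(type="cstarAlgType")]
HB.structure Definition CStarAlgebra (R : realType) :=
  {A of StarAlgebra R A & isCStarAlgebra R A}.

Definition star_subalgebra (R : realType) (A : starAlgType R) (B : set A) :=
  [/\ B 1,
      forall (c : R[i]) x y, B x -> B y -> B (c *: x + y),
      forall x y, B x -> B y -> B (x * y) &
      forall x, B x -> B (star x)].

Definition star_generated (R : realType) (A : starAlgType R) (X : set A) :=
  smallest (@star_subalgebra R A) X.

HB.instance Definition _ (R : realType) :=
  isStarAlgebra.Build R R[i]^o (@rmorphD _ _ conjc) (@rmorphM _ _ conjc)
    (fun x y => etrans (rmorphM conjc x y) (mulrC _ _)) (@conjcK R).

Section FunctionStarAlgebra.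
Variables (R : realType) (T : pointedType).
Implicit Types f g : T -> R[i]^o.

Let fun_scalerAl (c : R[i]) f g : c *: (f * g) = c *: f * g.
Proof. by apply/funext => t; exact: scalerAl. Qed.

Let fun_scalerAr (c : R[i]) f g : c *: (f * g) = f * (c *: g).
Proof. by apply/funext => t; exact: scalerAr. Qed.

HB.instance Definition _ :=
  GRing.Lmodule_isLalgebra.Build R[i] (T -> R[i]^o) fun_scalerAl.
HB.instance Definition _ :=
  GRing.Lalgebra_isAlgebra.Build R[i] (T -> R[i]^o) fun_scalerAr.

Definition fun_star f : T -> R[i]^o := fun t => star (f t).

Let fun_starD f g : fun_star (f + g) = fun_star f + fun_star g.
Proof. by apply/funext => t; rewrite /fun_star starD. Qed.

Let fun_starZ (c : R[i]) f : fun_star (c *: f) = c^* *: fun_star f.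
Proof. by apply/funext => t; rewrite /fun_star starZ. Qed.

Let fun_starM f g : fun_star (f * g) = fun_star g * fun_star f.
Proof. by apply/funext => t; rewrite /fun_star starM. Qed.

Let fun_starK : involutive fun_star.
Proof. by move=> f; apply/funext => t; rewrite /fun_star starK. Qed.

HB.instance Definition _ := isStarAlgebra.Build R (T -> R[i]^o)
  fun_starD fun_starZ fun_starM fun_starK.

End FunctionStarAlgebra.

(* An element of the algebraic tensor product of V and W is given by a list of
   pairs (v, w), standing for the sum of the v (x) w. Two lists give the same
   tensor when every bilinear map takes the same value on them. *)
Section Tensors.
Variable R : realType.

Definition tensor (V W : lmodType R[i]) := seq (V * W).

Definition tensor_eq (V W : lmodType R[i]) (s t : tensor V W) :=
  forall (U : lmodType R[i]) (f : {bilinear V -> W -> U}),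
    \sum_(p <- s) f p.1 p.2 = \sum_(p <- t) f p.1 p.2.

Definition tensor_scale (V W : lmodType R[i]) (c : R[i]) (s : tensor V W)
  : tensor V W := [seq (c *: p.1, p.2) | p <- s].

Definition tensor_map (V W V' W' : lmodType R[i]) (f : V -> V') (g : W -> W')
  (s : tensor V W) : tensor V' W' := [seq (f p.1, g p.2) | p <- s].

Definition tensor_mul (A B : algType R[i]) (s t : tensor A B) : tensor A B :=
  [seq (p.1 * q.1, p.2 * q.2) | p <- s, q <- t].

Definition tensor_star (A B : starAlgType R) (s : tensor A B) : tensor A B :=
  tensor_map star star s.

Definition tensor_in (V W : lmodType R[i]) (X : set V) (Y : set W)
  (s : tensor V W) := forall p, p \in s -> X p.1 /\ Y p.2.

End Tensors.

(* A coalgebra realised as a subspace [copoly] of an ambient vector space;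
   [comul x s] means that the tensor s, with legs in [copoly], is the
   comultiplication of x. *)
Record coalgebra_data (R : realType) := CoalgebraData {
  coambient : lmodType R[i];
  copoly : set coambient;
  comul : coambient -> tensor coambient coambient -> Prop;
  counit : coambient -> R[i]
}.

Section Coalgebras.
Variable R : realType.

Record coalgebra_iso (H K : coalgebra_data R)
    (theta : coambient H -> coambient K) : Prop := {
  coiso_linear : forall (c : R[i]) x y, copoly x -> copoly y ->
    theta (c *: x + y) = c *: theta x + theta y;
  coiso_bij : set_bij (copoly (c:=H)) (copoly (c:=K)) theta;
  coiso_comul : forall x s, copoly x -> comul x s ->
    comul (theta x) (tensor_map theta theta s);
  coiso_counit : forall x, copoly x -> counit (theta x) = counit x
}.

(* A finite dimensional corepresentation, as a matrix of coefficients with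
   rows and columns indexed by a finite type. *)
Definition corepresentation (H : coalgebra_data R) (I : finType)
    (v : I -> I -> coambient H) :=
  forall i j, [/\ copoly (v i j),
                  comul (v i j) [seq (v i k, v k j) | k <- enum I] &
                  counit (v i j) = (i == j)%:R].

Definition corep_equiv (H : coalgebra_data R) (I J : finType)
    (v : I -> I -> coambient H) (w : J -> J -> coambient H) :=
  exists (S : I -> J -> R[i]) (T : J -> I -> R[i]),
    [/\ forall i i', \sum_j S i j * T j i' = (i == i')%:R,
        forall j j', \sum_i T j i * S i j' = (j == j')%:R &
        forall i j, \sum_k S k j *: v i k = \sum_k S i k *: w k j].

(* The representations v of H and w of K correspond to each other via theta. *)
Definition corresponds (H K : coalgebra_data R)
    (theta : coambient H -> coambient K) (I J : finType)
    (v : I -> I -> coambient H) (w : J -> J -> coambient K) :=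
  [/\ corepresentation v, corepresentation w &
      corep_equiv w (fun i j => theta (v i j))].

End Coalgebras.

Section OrthogonalGroup.
Variables (R : realType) (N : nat).

Definition is_orthogonal (g : 'M[R]_N) := g^T *m g == 1%:M.

Definition O_group := {g : 'M[R]_N | is_orthogonal g}.

Let O_one_subproof : is_orthogonal 1%:M.
Proof. by rewrite /is_orthogonal trmx1 mulmx1. Qed.

Definition O_one : O_group := exist is_orthogonal _ O_one_subproof.

Let O_mul_subproof (g h : O_group) :
  is_orthogonal (sval g *m sval h).
Proof.
case: g h => [g /= /eqP gP] [h /= /eqP hP]; rewrite /is_orthogonal.
by rewrite trmx_mul mulmxA -(mulmxA _ g^T) gP mulmx1 hP.
Qed.

Definition O_mul (g h : O_group) : O_group :=
  exist is_orthogonal _ (O_mul_subproof g h).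

HB.instance Definition _ := Choice.on O_group.
HB.instance Definition _ := isPointed.Build O_group O_one.

Definition coord_fun (i j : 'I_N) : O_group -> R[i]^o :=
  fun g => (sval g i j)%:C.

Definition O_poly : set (O_group -> R[i]^o) :=
  star_generated [set f | exists i j, f = coord_fun i j].

(* A tensor of functions on O_N is determined by the function it defines on
   O_N x O_N. *)
Definition O_coalgebra : coalgebra_data R :=
  @CoalgebraData R (O_group -> R[i]^o) O_poly
    (fun f s => tensor_in O_poly O_poly s /\
       forall g h, f (O_mul g h) = \sum_(p <- s) p.1 g * p.2 h)
    (fun f => f O_one).

End OrthogonalGroup.

Section OBar.
Variables (R : realType) (N : nat).

Record obar_relations (A : starAlgType R) (u : 'M[A]_N) : Prop := {
  obar_selfadj : forall i j, star (u i j) = u i j;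
  obar_mulmxT : u *m u^T = 1%:M;
  obar_mulTmx : u^T *m u = 1%:M;
  obar_anticomm : forall i j k l, (i, j) != (k, l) -> (i == k) || (j == l) ->
    u i j * u k l = - (u k l * u i j);
  obar_comm : forall i j k l, i != k -> j != l ->
    u i j * u k l = u k l * u i j
}.

Definition star_hom (A B : starAlgType R) (f : {lrmorphism A -> B}) :=
  forall x, f (star x) = star (f x).

Definition obar_universal (A : cstarAlgType R) (u : 'M[A]_N) :=
  forall (B : cstarAlgType R) (v : 'M[B]_N), obar_relations v ->
    exists f : {lrmorphism A -> B},
      [/\ star_hom f, forall i j, f (u i j) = v i j &
          forall f' : {lrmorphism A -> B}, star_hom f' ->
            (forall i j, f' (u i j) = v i j) -> f' =1 f].

Definition obar_poly (A : starAlgType R) (u : 'M[A]_N) : set A :=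
  star_generated [set x | exists i j, x = u i j].

Record obar_comul_spec (A : starAlgType R) (u : 'M[A]_N)
    (Delta : A -> tensor A A) : Prop := {
  obar_comul_in : forall x, obar_poly u x ->
    tensor_in (obar_poly u) (obar_poly u) (Delta x);
  obar_comul_linear : forall (c : R[i]) x y, obar_poly u x -> obar_poly u y ->
    tensor_eq (Delta (c *: x + y)) (tensor_scale c (Delta x) ++ Delta y);
  obar_comul1 : tensor_eq (Delta 1) [:: (1, 1)];
  obar_comulM : forall x y, obar_poly u x -> obar_poly u y ->
    tensor_eq (Delta (x * y)) (tensor_mul (Delta x) (Delta y));
  obar_comul_star : forall x, obar_poly u x ->
    tensor_eq (Delta (star x)) (tensor_star (Delta x));
  obar_comulE : forall i j,
    tensor_eq (Delta (u i j)) [seq (u i k, u k j) | k <- enum 'I_N]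
}.

Record obar_counit_spec (A : starAlgType R) (u : 'M[A]_N)
    (eps : A -> R[i]^o) : Prop := {
  obar_counit_linear : forall (c : R[i]) x y, obar_poly u x -> obar_poly u y ->
    eps (c *: x + y) = c *: eps x + eps y;
  obar_counit1 : eps 1 = 1;
  obar_counitM : forall x y, obar_poly u x -> obar_poly u y ->
    eps (x * y) = eps x * eps y;
  obar_counit_star : forall x, obar_poly u x -> eps (star x) = star (eps x);
  obar_counitE : forall i j, eps (u i j) = (i == j)%:R
}.

(* [obar_alg] is C(Obar_N) and [obar_poly obar_u] is the Hopf star-algebra
   O(Obar_N); the comultiplication, with values in the algebraic tensor product,
   and the counit are meaningful on O(Obar_N) only. *)
Record obar := OBar {
  obar_alg : cstarAlgType R;
  obar_u : 'M[obar_alg]_N;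
  obar_relationsP : obar_relations obar_u;
  obar_universalP : obar_universal obar_u;
  obar_comul : obar_alg -> tensor obar_alg obar_alg;
  obar_comulP : obar_comul_spec obar_u obar_comul;
  obar_counit : obar_alg -> R[i]^o;
  obar_counitP : obar_counit_spec obar_u obar_counit
}.

Definition obar_coalgebra (Q : obar) : coalgebra_data R :=
  @CoalgebraData R (obar_alg Q) (obar_poly (obar_u Q))
    (fun x s => tensor_in (obar_poly (obar_u Q)) (obar_poly (obar_u Q)) s /\
       tensor_eq (obar_comul x) s)
    (@obar_counit Q).

End OBar.

Section Cube.
Variable N : nat.

Definition cube := {ffun 'I_N -> 'Z_2}.

Definition cube_gen (i : 'I_N) : cube := [ffun j => (j == i)%:R].

Definition cube_dot (i j : cube) : nat := (\sum_(x < N) i x * j x)%N.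

Lemma cube_dotC (i j : cube) : cube_dot i j = cube_dot j i.
Proof. by apply: eq_bigr => x _; rewrite mulnC. Qed.

End Cube.

(* Functions on [cube N] with values in B are used in two ways: x stands for
   sum_g x(g) (x) g in B (x) C^*(Z_2^N), with the convolution product, and for
   sum_g x(g) (x) delta_g in B (x) C(Z_2^N). *)
Section GroupAlgebra.
Variables (R : realType) (N : nat) (B : starAlgType R).
Implicit Types x y : cube N -> B.

Definition point_mass (b : B) (g : cube N) : cube N -> B :=
  fun h => if h == g then b else 0.

Definition convolution x y : cube N -> B := fun g => \sum_h x h * y (g - h).

Definition convolution_star x : cube N -> B := fun g => star (x (- g)).

(* id (x) beta *)
Definition fourier x : cube N -> B :=
  fun j => \sum_i (-1) ^+ cube_dot i j *: x i.

Definition fourier_inv x : cube N -> B :=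
  fun i => (2 ^+ N)^-1 *: (\sum_j (-1) ^+ cube_dot i j *: x j).

Let fourier_orthogonal (i k : cube N) :
  \sum_j (-1) ^+ cube_dot i j * (-1) ^+ cube_dot j k
    = (2 ^+ N * (i == k)%:R :> R[i]).
Proof.
pose chi (a b : 'Z_2) : R[i] := (-1) ^+ (a * b)%N.
transitivity (\prod_x \sum_(a : 'Z_2) chi (i x) a * chi a (k x)).
  rewrite bigA_distr_bigA; apply: eq_bigr => j _.
  by rewrite /cube_dot !expr_sum -big_split.
have chiE a b : \sum_c chi a c * chi c b = 2 * (a == b)%:R.
  rewrite !big_ord_recl big_ord0 /chi.
  by case: a b => [[|[|]]] // ? [[|[|]]] // ?;
    rewrite /= ?muln1 ?mul1n ?muln0 ?mul0n ?expr0 ?expr1 ?mulr1 ?mul1r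
      ?mulrN1 ?opprK ?addr0 ?subrr ?mulr0.
under eq_bigr do rewrite chiE.
rewrite big_split prodr_const card_ord /=; congr (_ * _).
have [->|neq_ik] := eqVneq i k; first by rewrite big1 // => x _; rewrite eqxx.
have [z neq_z] : exists z : 'I_N, i z != k z.
  apply/existsP; apply: contra_neqT neq_ik => /existsPn eq_ik.
  by apply/ffunP => z; apply/eqP; rewrite -[_ == _]negbK eq_ik.
by rewrite (bigD1 z) //= (negPf neq_z) mul0r.
Qed.

Let two_expN_neq0 : (2 : R[i]) ^+ N != 0.
Proof. by rewrite expf_neq0 // pnatr_eq0. Qed.

Let fourier_twice x i :
  \sum_j (-1) ^+ cube_dot i j *: (\sum_k (-1) ^+ cube_dot j k *: x k)
    = (2 ^+ N : R[i]) *: x i.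
Proof.
under eq_bigr do rewrite scaler_sumr; rewrite exchange_big /=.
transitivity (\sum_k (2 ^+ N * (i == k)%:R : R[i]) *: x k).
  apply: eq_bigr => k _; rewrite -fourier_orthogonal scaler_suml.
  by apply: eq_bigr => j _; rewrite scalerA.
rewrite (bigD1 i) //= eqxx mulr1 big1 ?addr0 // => k neq_ki.
by rewrite eq_sym (negPf neq_ki) mulr0 scale0r.
Qed.

Lemma fourierK : cancel fourier fourier_inv.
Proof.
move=> x; apply/funext => i.
transitivity ((2 ^+ N : R[i])^-1 *: ((2 ^+ N : R[i]) *: x i)).
  rewrite -fourier_twice; congr (_ *: _); apply: eq_bigr => j _.
  by congr (_ *: _); apply: eq_bigr => k _; rewrite cube_dotC.
by rewrite scalerA mulVf // scale1r.
Qed.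

Lemma fourier_invK : cancel fourier_inv fourier.
Proof.
move=> x; apply/funext => i; rewrite /fourier.
transitivity ((2 ^+ N : R[i])^-1 *: ((2 ^+ N : R[i]) *: x i)).
  rewrite -fourier_twice scaler_sumr; apply: eq_bigr => j _.
  by rewrite /fourier_inv scalerA mulrC -scalerA cube_dotC.
by rewrite scalerA mulVf // scale1r.
Qed.

End GroupAlgebra.

Section MagicRepresentation.
Variables (R : realType) (N : nat) (Q : obar R N).
Local Notation A := (obar_alg Q).
Local Notation u := (obar_u Q).

Record hypercube_coaction (Phi : (cube N -> R[i]^o) -> (cube N -> A)) : Prop := {
  coaction_linear : linear Phi;
  coaction1 : Phi (point_mass 1 0) = point_mass 1 0;
  coactionM : forall x y,
    Phi (convolution x y) = convolution (Phi x) (Phi y);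
  coaction_star : forall x,
    Phi (convolution_star x) = convolution_star (Phi x);
  coaction_coassoc : forall x h,
    tensor_eq (obar_comul (Phi x h))
              [seq (Phi x g, Phi (point_mass 1 g) h) | g <- enum (cube N)];
  coaction_counit : forall x h, obar_counit (Phi x h) = x h;
  coactionE : forall i, Phi (point_mass 1 (cube_gen i)) =
    \sum_j point_mass (u i j) (cube_gen j)
}.

(* Psi = (id (x) beta) Phi beta^-1, whose coefficient of delta_k at delta_i is
   w_(i,k). *)
Definition cube_coaction (Phi : (cube N -> R[i]^o) -> (cube N -> A)) :
  (cube N -> R[i]^o) -> (cube N -> A) := fun x => fourier (Phi (fourier_inv x)).

Definition magic_rep (Phi : (cube N -> R[i]^o) -> (cube N -> A)) (i k : cube N)
  : A := cube_coaction Phi (point_mass 1 i) k.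

End MagicRepresentation.

Section AntisymmetricRepresentation.
Variables (R : realType) (N : nat).

(* The direct sum of the r-fold tensor powers of C^N, for 0 <= r <= N, in the
   basis e_{t 0} (x) ... (x) e_{t (r-1)} for r <= N and t : 'I_r -> 'I_N. *)
Definition multi_index := {r : 'I_N.+1 & {ffun 'I_r -> 'I_N}}.

Definition MultiIndex (r : 'I_N.+1) (t : {ffun 'I_r -> 'I_N}) : multi_index :=
  Tagged (fun r : 'I_N.+1 => {ffun 'I_r -> 'I_N}) t.

Definition tensor_space := {ffun multi_index -> R[i]^o}.

Definition pure_tensor (p : multi_index) : tensor_space :=
  [ffun q => (q == p)%:R].

Definition antisym_tensor (r : 'I_N.+1) (t : {ffun 'I_r -> 'I_N})
  : tensor_space :=
  \sum_(s : 'S_r) (-1) ^+ s *: pure_tensor (MultiIndex [ffun x => t (s x)]).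

Definition increasing (r : nat) : {set {ffun 'I_r -> 'I_N}} :=
  [set t : {ffun 'I_r -> 'I_N} |
     [forall x : 'I_r, forall y : 'I_r, (x < y)%N ==> (t x < t y)%N]]%SET.

Definition antisym_space (r : 'I_N.+1) : {vspace tensor_space} :=
  <<[seq antisym_tensor t | t <- enum (increasing r)]>>%VS.

Definition antisym_sum : {vspace tensor_space} :=
  (\sum_(r < N.+1) antisym_space r)%VS.

Definition tensor_action (g : O_group R N) (v : tensor_space) : tensor_space :=
  [ffun q : multi_index => \sum_(t : {ffun 'I_(tag q) -> 'I_N})
     (\prod_(x < tag q) (sval g (tagged q x) (t x))%:C) * v (MultiIndex t)].

(* The matrix, in the basis b, of the restriction of the action of O_N to the
   invariant subspace spanned by b. *)
Definition action_coeff (n : nat) (b : n.-tuple tensor_space) (i j : 'I_n)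
  : O_group R N -> R[i]^o := fun g => coord b i (tensor_action g b`_j).

End AntisymmetricRepresentation.

Section Twisting.
Variables (R : realType) (N : nat) (Q : obar R N).

Definition twist_sign (i k : 'I_N) : R[i] := if (i < k)%N then -1 else 1.

Record twisting (theta : (O_group R N -> R[i]^o) -> obar_alg Q) : Prop := {
  twisting_iso : @coalgebra_iso R (O_coalgebra R N) (obar_coalgebra Q) theta;
  twistingE : forall (m : nat) (i j : 'I_m -> 'I_N),
    theta ((\prod_(p : 'I_m * 'I_m | (p.1 < p.2)%N)
              (twist_sign (i p.1) (i p.2) * twist_sign (j p.1) (j p.2)))
           *: \prod_(x < m) @coord_fun R N (i x) (j x))
    = \prod_(x < m) obar_u Q (i x) (j x)
}.

End Twisting.

(* Main.v *)
Require Import Defs.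
From mathcomp Require Import all_boot all_order all_algebra all_fingroup.
From mathcomp Require Import sesquilinear.
From mathcomp Require Import boolp classical_sets functions reals topology.
From mathcomp Require Import complex.
Set Implicit Arguments.
Unset Strict Implicit.
Unset Printing Implicit Defensive.
Import Order.TTheory GRing.Theory Num.Theory.
Local Open Scope ring_scope.

(** Let [phi] be the matrix of the coaction [Phi] in the basis of group elements
    ([generator_rep]), so that Phi(g) is the sum over h of
    phi_(g,h) (x) h. The Fourier transform conjugates the magic representation
    [w] into [phi], by the matrix of the characters of the hypercube. So it is
    enough to compare [phi] with the image of the antisymmetric representation.

    A vertex of the cube is a product g_(t 0) ... g_(t (r-1)) with [t]
    increasing, the enumeration of the support of the vertex; the wedges
    xi_t = e_(t 0) /\ ... /\ e_(t (r-1)) form a basis of the sum of the X_r. In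
    these two bases the two representations become the same matrix: the entry
    of [phi] at two vertices is the image by [theta] of the corresponding entry
    of the antisymmetric representation, which is a minor of (u_ij)
    ([generator_rep_wedge]).

    As [Phi] is multiplicative, the entry of [phi] at (g_t, h) is the sum of the
    words ubar_(t 0, j 0) ... ubar_(t (r-1), j (r-1)), over all tuples [j] with
    g_j = h ([generator_rep_weight]). Each word is the image by [theta] of the
    corresponding commutative monomial with a sign. On an injective [j] the
    total sign is the sign of the permutation that sorts [j], which gives the
    minor. The tuples [j] with repetitions must contribute zero, although no
    single word does. The reason is that the cube is commutative: g_t, hence
    phi_(g_t, h), is unchanged when [t] is permuted, whereas the sign of the
    twist is antisymmetric in [t]. Averaging over the permutations of [t]
    replaces each monomial by a determinant with columns indexed by [j], which
    vanishes as soon as [j] has a repetition ([sum_minor_sum]).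

    The equivalence with an arbitrary basis [b] of the sum of the X_r is a
    change of basis, because evaluating an antisymmetric tensor at the
    increasing tuples gives its coordinates in the wedges
    ([alternating_wedge_sum]). That [w] is a corepresentation follows from the
    equivalence and from the fact that [theta] is an isomorphism of
    coalgebras. *)

(** * Subspaces and star-subalgebras *)

(** The twisting isomorphism, the comultiplication and the counit are known
    to be linear only on the Hopf algebras O(O_N) and O(Obar_N), which sit inside
    larger spaces. *)
Section LinearOnSubspace.
Variables (K : pzRingType) (V W : lmodType K) (B : set V) (f : V -> W).
Hypothesis B0 : B 0.
Hypothesis B_linear : forall (c : K) x y, B x -> B y -> B (c *: x + y).
Hypothesis f_linear : forall (c : K) x y, B x -> B y ->
  f (c *: x + y) = c *: f x + f y.

Lemma subspace_sum (I : Type) (r : seq I) (P : pred I) (c : I -> K)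
    (x : I -> V) :
  (forall i, B (x i)) -> B (\sum_(i <- r | P i) c i *: x i).
Proof.
move=> Bx; elim: r => [|i r IHr]; first by rewrite big_nil.
by rewrite big_cons; case: ifP => // _; exact: B_linear.
Qed.

Lemma linear_on0 : f 0 = 0.
Proof.
have := f_linear 1 B0 B0; rewrite !scale1r addr0 => f0D.
by apply: (addrI (f 0)); rewrite -f0D addr0.
Qed.

Lemma linear_on_scale (c : K) x : B x -> f (c *: x) = c *: f x.
Proof.
by move=> Bx; rewrite -[in LHS](addr0 (c *: x)) f_linear // linear_on0 addr0.
Qed.

Lemma linear_on_sum (I : Type) (r : seq I) (P : pred I) (c : I -> K)
    (x : I -> V) :
  (forall i, B (x i)) ->
  f (\sum_(i <- r | P i) c i *: x i) = \sum_(i <- r | P i) c i *: f (x i).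
Proof.
move=> Bx; elim: r => [|i r IHr]; first by rewrite !big_nil linear_on0.
rewrite !big_cons; case: ifP => // _.
by rewrite f_linear ?IHr //; exact: subspace_sum.
Qed.

End LinearOnSubspace.

Section StarSubalgebra.
Variables (R : realType) (A : starAlgType R).

Lemma star_generated_subalgebra (X : set A) :
  star_subalgebra (star_generated X).
Proof.
split=> [B [[]] //|c x y Xx Xy B [BB XB]|x y Xx Xy B [BB XB]|x Xx B [BB XB]];
  have [_ BD BM BS] := BB.
- by apply: BD; [exact: Xx | exact: Xy].
- by apply: BM; [exact: Xx | exact: Xy].
- by apply: BS; exact: Xx.
Qed.

Variable B : set A.
Hypothesis B_subalgebra : star_subalgebra B.

Lemma star_subalgebra0 : B 0.
Proof.
have [B1 BD _ _] := B_subalgebra.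
by have := BD (-1) 1 1 B1 B1; rewrite scaleN1r addNr.
Qed.

Lemma star_subalgebra_prod (I : Type) (r : seq I) (P : pred I) (x : I -> A) :
  (forall i, B (x i)) -> B (\prod_(i <- r | P i) x i).
Proof.
have [B1 _ BM _] := B_subalgebra.
by move=> Bx; elim/big_ind: _.
Qed.

End StarSubalgebra.

(** * Equivalence of corepresentations *)

Section Corepresentations.
Variable R : realType.

Lemma corep_equiv_trans (H : coalgebra_data R) (I J K : finType)
    (x : I -> I -> coambient H) (y : J -> J -> coambient H)
    (z : K -> K -> coambient H) :
  corep_equiv x y -> corep_equiv y z -> corep_equiv x z.
Proof.
move=> [S [T [ST TS xS]]] [S' [T' [ST' TS' yS]]].
exists (fun i k => \sum_j S i j * S' j k), (fun k i => \sum_j T' k j * T j i).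
have cancel_mul (I1 J1 K1 : finType) (a : I1 -> J1 -> R[i]) (b : J1 -> I1 -> R[i])
    (a' : J1 -> K1 -> R[i]) (b' : K1 -> J1 -> R[i]) :
  (forall i i', \sum_j a i j * b j i' = (i == i')%:R) ->
  (forall j j', \sum_k a' j k * b' k j' = (j == j')%:R) ->
  forall i i', \sum_k (\sum_j a i j * a' j k) * (\sum_j b' k j * b j i')
    = (i == i')%:R.
  move=> ab ab' i i'; rewrite -ab.
  under eq_bigr do rewrite mulr_suml.
  rewrite exchange_big /=; apply: eq_bigr => j _.
  under eq_bigr do rewrite mulr_sumr.
  rewrite exchange_big /= (bigD1 j) //= [X in _ + X]big1 => [|j' neq_j'j].
    rewrite addr0; under eq_bigr do rewrite -mulrA (mulrA (a' _ _)).
    by rewrite -mulr_sumr -mulr_suml ab' eqxx mul1r.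
  under eq_bigr do rewrite -mulrA (mulrA (a' _ _)).
  by rewrite -mulr_sumr -mulr_suml ab' eq_sym (negPf neq_j'j) mul0r mulr0.
split=> [||i k]; [exact: cancel_mul ST ST' | exact: cancel_mul TS' TS |].
transitivity (\sum_j S' j k *: (\sum_l S l j *: x i l)).
  under [RHS]eq_bigr do rewrite scaler_sumr.
  rewrite exchange_big /=; apply: eq_bigr => l _; rewrite scaler_suml.
  by apply: eq_bigr => j _; rewrite scalerA mulrC.
transitivity (\sum_j S i j *: (\sum_l S' l k *: y j l)).
  under eq_bigr do rewrite xS scaler_sumr.
  under [RHS]eq_bigr do rewrite scaler_sumr.
  rewrite exchange_big /=; apply: eq_bigr => j _; apply: eq_bigr => l _.
  by rewrite !scalerA mulrC.
under eq_bigr do rewrite yS scaler_sumr.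
under [RHS]eq_bigr do rewrite scaler_suml.
rewrite exchange_big /=; apply: eq_bigr => j _; apply: eq_bigr => l _.
by rewrite scalerA.
Qed.

Lemma coalgebra_iso_corep (H K : coalgebra_data R)
    (theta : coambient H -> coambient K) (I : finType)
    (v : I -> I -> coambient H) :
  coalgebra_iso theta -> corepresentation v ->
  @corepresentation R K I (fun i j => theta (v i j)).
Proof.
move=> [_ [theta_fun _ _] theta_comul theta_counit] v_corep i j.
have [v_poly v_comul v_counit] := v_corep i j.
split; first exact: theta_fun.
  by have := theta_comul _ _ v_poly v_comul; rewrite /tensor_map -map_comp.
by rewrite theta_counit.
Qed.

Section ObarCorepresentations.
Variables (N : nat) (Q : obar R N).
Local Notation Qpoly := (obar_poly (obar_u Q)).

Let Qpoly_subalgebra := star_generated_subalgebra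
  [set x | exists i j, x = obar_u Q i j]%classic.

(* Equality of tensors is tested against bilinear maps, so the comultiplication
   is only used through its composition with a bilinear map. *)
Let comul_eval (U : lmodType R[i])
    (f : {bilinear obar_alg Q -> obar_alg Q -> U}) x :=
  \sum_(p <- obar_comul x) f p.1 p.2.

Let comul_eval_linear (U : lmodType R[i])
    (f : {bilinear obar_alg Q -> obar_alg Q -> U})
    (c : R[i]) x y :
  Qpoly x -> Qpoly y ->
  comul_eval f (c *: x + y) = c *: comul_eval f x + comul_eval f y.
Proof.
move=> Qx Qy; rewrite /comul_eval.
rewrite (obar_comul_linear (obar_comulP Q) c Qx Qy f) big_cat /= scaler_sumr.
congr (_ + _); rewrite big_map; apply: eq_bigr => p _ /=.
by rewrite linearZl_LR.
Qed.

(** Conjugating the identity for the comultiplication of [v] by scalar matrices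
    inserts T S = 1 between the two legs of the tensor. *)
Lemma obar_corep_equiv (I J : finType) (w : I -> I -> obar_alg Q)
    (v : J -> J -> obar_alg Q) :
  @corep_equiv R (obar_coalgebra Q) I J w v ->
  @corepresentation R (obar_coalgebra Q) J v ->
  @corepresentation R (obar_coalgebra Q) I w.
Proof.
move=> [S [T [ST TS wS]]] v_corep.
have [_ Qlin _ _] := Qpoly_subalgebra.
have Q0 : Qpoly 0 := star_subalgebra0 Qpoly_subalgebra.
have Qv k l : Qpoly (v k l) by have [] := v_corep k l.
(* w = S v T *)
have wE i j : w i j = \sum_p (S i p.1 * T p.2 j) *: v p.1 p.2.
  transitivity (\sum_j' (j' == j)%:R *: w i j').
    rewrite (bigD1 j) //= eqxx scale1r big1 ?addr0 // => j' /negPf->.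
    by rewrite scale0r.
  under eq_bigr => j' _ do rewrite -ST scaler_suml.
  rewrite exchange_big /=.
  transitivity (\sum_l T l j *: (\sum_k S i k *: v k l)).
    apply: eq_bigr => l _; rewrite -wS scaler_sumr; apply: eq_bigr => j' _.
    by rewrite scalerA mulrC.
  rewrite -(pair_bigA _ (fun k l => (S i k * T l j) *: v k l)) exchange_big /=.
  by apply: eq_bigr => l _; rewrite scaler_sumr; apply: eq_bigr => k _;
    rewrite scalerA mulrC.
have Qw i j : Qpoly (w i j) by rewrite wE; apply: (subspace_sum Q0 Qlin).
move=> i j; split; first exact: Qw.
  split=> [p /mapP[k _ ->] | U f]; first by split; exact: Qw.
  rewrite -/(comul_eval f (w i j)) big_map big_enum /=.
  rewrite wE (linear_on_sum Q0 Qlin (@comul_eval_linear U f)) => [|p];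
    last exact: Qv.
  transitivity (\sum_p (S i p.1 * T p.2 j) *: \sum_k f (v p.1 k) (v k p.2)).
    apply: eq_bigr => p _; congr (_ *: _).
    have [_ [_ v_comul] _] := v_corep p.1 p.2.
    by rewrite /comul_eval v_comul big_map big_enum.
  transitivity (\sum_k f (\sum_l S i l *: v l k) (\sum_l T l j *: v k l)).
    under eq_bigr do rewrite scaler_sumr.
    rewrite exchange_big /=; apply: eq_bigr => k _.
    rewrite linear_sumlz.
    rewrite -(pair_bigA _ (fun l m => (S i l * T m j) *: f (v l k) (v k m))) /=.
    apply: eq_bigr => l _; rewrite linear_sumr; apply: eq_bigr => m _.
    by rewrite linearZl_LR linearZr_LR scalerA.
  transitivity (\sum_k \sum_l S l k *: f (w i l) (\sum_l T l j *: v k l)).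
    apply: eq_bigr => k _; rewrite -wS linear_sumlz.
    by apply: eq_bigr => l _; rewrite linearZl_LR.
  rewrite exchange_big /=; apply: eq_bigr => l _.
  under eq_bigr do rewrite -linearZr_LR.
  rewrite -linear_sumr; congr (f _ _).
  rewrite wE -(pair_bigA _ (fun k m => (S l k * T m j) *: v k m)) /=.
  apply: eq_bigr => k _; rewrite scaler_sumr; apply: eq_bigr => m _.
  by rewrite scalerA.
rewrite /= wE.
have epsP := obar_counitP Q.
rewrite (linear_on_sum Q0 Qlin (obar_counit_linear epsP)) => [|p]; last exact: Qv.
rewrite -ST -(pair_bigA _ (fun k l => (S i k * T l j) *: obar_counit (v k l))) /=.
apply: eq_bigr => k _; rewrite (bigD1 k) //= big1 => [|l neq_lk].
  have [_ _ /= ->] := v_corep k k.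
  by rewrite eqxx addr0 [LHS]mulr1.
have [_ _ /= ->] := v_corep k l.
by rewrite eq_sym (negPf neq_lk) [LHS]mulr0.
Qed.

End ObarCorepresentations.

End Corepresentations.

(** * Signs of tuples *)

Section Signs.
Variables (R : realType) (N r : nat).
Implicit Types (t j : {ffun 'I_r -> 'I_N}) (s : 'S_r).

Definition reorder t s : {ffun 'I_r -> 'I_N} := [ffun x => t (s x)].

Lemma reorder_inj t s : injectiveb (reorder t s) = injectiveb t.
Proof.
apply/injectiveP/injectiveP => t_inj x y.
  move=> eq_xy; apply: (perm_inj (s := s^-1%g)); apply: t_inj.
  by rewrite !ffunE !permKV.
by rewrite !ffunE => /t_inj/perm_inj.
Qed.

Lemma reorder_bij s : bijective (fun t => reorder t s).
Proof.
exists (fun t => reorder t s^-1%g) => t; apply/ffunP => x;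
  by rewrite !ffunE ?permKV ?permK.
Qed.

(** The sign of the permutation sorting [t], and 0 when [t] has a repetition. *)
Definition alt_sign t : R[i] :=
  \prod_(p : 'I_r * 'I_r | (p.1 < p.2)%N)
     (Num.sg ((t p.2)%:Z - (t p.1)%:Z))%:~R.

(** The product of the differences of the entries is a Vandermonde determinant,
    which gives at once the effect of a permutation and the vanishing on
    repetitions. *)
Lemma alt_sign_Vandermonde t :
  alt_sign t = (Num.sg (\det (Vandermonde r (\row_x (t x)%:Z))))%:~R.
Proof.
rewrite det_Vandermonde pair_big_dep /= (big_morph _ (@sgrM _) (@sgr1 _)).
rewrite rmorph_prod; apply: eq_bigr => p _.
by rewrite !mxE.
Qed.

Lemma alt_sign_reorder t s : alt_sign (reorder t s) = (-1) ^+ s * alt_sign t.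
Proof.
rewrite !alt_sign_Vandermonde.
have -> : Vandermonde r (\row_x (reorder t s x)%:Z)
    = col_perm s (Vandermonde r (\row_x (t x)%:Z)).
  by apply/matrixP => x y; rewrite !mxE ffunE.
rewrite col_permE det_mulmx det_perm odd_permV sgrM intrM mulrC.
by rewrite sgrX sgrN1 rmorphXn rmorphN1.
Qed.

Lemma alt_sign_eq0 t : ~~ injectiveb t -> alt_sign t = 0.
Proof.
case/injectivePn => x [y neq_xy t_xy].
rewrite alt_sign_Vandermonde -det_tr; set V := _^T.
have -> : \det V = 0.
  by apply: (determinant_alternate neq_xy) => z; rewrite !mxE t_xy.
by rewrite sgr0.
Qed.

Lemma increasing_inj t : t \in increasing N r -> injective t.
Proof.
rewrite inE => /forallP t_incr.
have mono (x y : 'I_r) : (x < y)%N -> t x != t y.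
  move=> lt_xy; have := forallP (t_incr x) y; rewrite lt_xy /= => lt_t.
  by apply: contraTneq lt_t => ->; rewrite ltnn.
move=> x y t_xy; apply: contra_eq t_xy => neq_xy.
by case: (ltngtP x y) => [/mono//|/mono|/val_inj/eqP];
  rewrite ?(negPf neq_xy) // eq_sym.
Qed.

Lemma alt_sign_increasing t : t \in increasing N r -> alt_sign t = 1.
Proof.
rewrite inE => /forallP t_incr; rewrite /alt_sign big1 // => p lt_p.
have := forallP (t_incr p.1) p.2; rewrite lt_p /= => lt_t.
by rewrite gtr0_sg // subr_gt0 ltz_nat.
Qed.

(** One half of the sign of the twist of a monomial, coming from the row indices
    or from the column indices. *)
Definition tuple_twist t : R[i] :=
  \prod_(p : 'I_r * 'I_r | (p.1 < p.2)%N) twist_sign R (t p.1) (t p.2).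

Definition pair_parity : R[i] := \prod_(p : 'I_r * 'I_r | (p.1 < p.2)%N) -1.

Lemma pair_parityK : pair_parity * pair_parity = 1.
Proof. by rewrite -big_split big1 //= => p _; rewrite mulrNN mulr1. Qed.

(** For distinct i and k, s(i, k) is the opposite of the sign of k - i. On a
    repetition s is 1 and not 0, and the equality fails. *)
Lemma tuple_twistE t : injective t -> tuple_twist t = pair_parity * alt_sign t.
Proof.
move=> t_inj; rewrite -big_split; apply: eq_bigr => p lt_p /=.
have neq_t : t p.1 != t p.2.
  by apply: contraTneq lt_p => /t_inj->; rewrite ltnn.
rewrite /twist_sign; case: ltngtP => [lt_t|gt_t|/val_inj eq_t].
- by rewrite gtr0_sg ?mulr1 // subr_gt0 ltz_nat.
- by rewrite ltr0_sg ?mulrN1 ?opprK // subr_lt0 ltz_nat.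
- by rewrite eq_t eqxx in neq_t.
Qed.

(** The product of the generators g_(t x) of the cube, written additively. *)
Definition weight t : cube N := \sum_x cube_gen (t x).

Lemma weight_reorder t s : weight (reorder t s) = weight t.
Proof.
rewrite [RHS](reindex_inj (perm_inj (s := s))); apply: eq_bigr => x _.
by rewrite ffunE.
Qed.

Lemma weightE t y : injective t -> weight t y = (y \in codom t)%:R.
Proof.
move=> t_inj; rewrite sum_ffunE.
have [/codomP[x ->]|y_t] := boolP (y \in codom t).
  rewrite (bigD1 x) //= ffunE eqxx big1 ?addr0 // => x' neq_x.
  by rewrite ffunE (inj_eq t_inj) eq_sym (negPf neq_x).
rewrite big1 // => x _; rewrite ffunE; case: eqP => // y_tx.
by rewrite y_tx codom_f in y_t.
Qed.

End Signs.

(** * Alternating tensors and wedges *)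

Section AlternatingTensors.
Variables (R : realType) (N : nat).
Local Notation tensor_space := (tensor_space R N).
Implicit Types (p q : multi_index N) (v : tensor_space).

(** An injective tuple is determined, up to order, by its set of values, which
    is the support of its weight; in particular the lengths agree. *)
Lemma same_weight_reorder p q :
  injective (tagged p) -> injective (tagged q) ->
  weight (tagged p) = weight (tagged q) ->
  exists s : 'S_(tag p), q = MultiIndex (reorder (tagged p) s).
Proof.
case: p q => [r t] [r' t'] /= t_inj t'_inj eq_w.
have eq_codom : codom t' =i codom t.
  move=> y; have := congr1 (fun h : cube N => h y) eq_w.
  by by rewrite !weightE //; do 2!case: (y \in _) => //= /eqP.
have perm_codom : perm_eq (codom t') (codom t).
  by apply: uniq_perm => //; apply/injectiveP.
have eq_r : r' = r.
  apply: val_inj; have := perm_size perm_codom.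
  by rewrite !size_codom !card_ord.
subst r'.
have /tuple_permP[s /val_inj eq_t'] :
    perm_eq [tuple t' x | x < r] [tuple t x | x < r] by [].
exists s; congr (MultiIndex _); apply/ffunP => x; rewrite ffunE.
by have := congr1 (fun l => tnth l x) eq_t'; rewrite !tnth_mktuple.
Qed.

(** This closed formula for the coefficients of a wedge replaces the sum over
    permutations: the weight detects the rearrangements of [t], and the sign
    takes care of the order and of repetitions. *)
Lemma antisym_tensorE (r : 'I_N.+1) (t : {ffun 'I_r -> 'I_N}) q :
  t \in increasing N r ->
  antisym_tensor R t q
    = alt_sign R (tagged q) * (weight (tagged q) == weight t)%:R.
Proof.
move=> t_incr; have t_inj := increasing_inj t_incr.
rewrite sum_ffunE; under eq_bigr do rewrite !ffunE -/(reorder t _).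
have [[s ->]|q_t] := pselect (exists s, q = MultiIndex (reorder t s)).
  rewrite (bigD1 s) //= eqxx big1 => [|s' neq_s'].
    rewrite addr0 alt_sign_reorder alt_sign_increasing // weight_reorder eqxx.
    by rewrite !mulr1 [LHS]mulr1.
  rewrite /MultiIndex eq_Tagged /=.
  case: eqP => [/ffunP eq_t|_]; last by rewrite scaler0.
  by case/eqP: neq_s'; apply/permP => x; have := eq_t x; rewrite !ffunE => /t_inj.
rewrite big1 => [|s _]; last first.
  by case: (q =P _) => [q_ts|_]; [case: q_t; exists s | rewrite scaler0].
have [q_inj|/alt_sign_eq0->] := boolP (injectiveb (tagged q)); last by rewrite mul0r.
case: eqP => [eq_w|_]; last by rewrite mulr0.
have [s q_ts] := @same_weight_reorder (MultiIndex t) q t_inj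
  (injectiveP _ q_inj) (esym eq_w).
by case: q_t; exists s.
Qed.

Definition alternating v := forall (r : 'I_N.+1) (t : {ffun 'I_r -> 'I_N}) s,
  v (MultiIndex (reorder t s)) = (-1) ^+ s * v (MultiIndex t).

Lemma alternating_noninjective v q :
  alternating v -> ~~ injectiveb (tagged q) -> v q = 0.
Proof.
case: q => [r t] /= v_alt /injectivePn[x [y neq_xy t_xy]].
have := v_alt r t (tperm x y).
have -> : reorder t (tperm x y) = t.
  by apply/ffunP => z; rewrite ffunE; case: tpermP => // ->.
rewrite odd_tperm neq_xy expr1 mulN1r => /eqP.
by rewrite -addr_eq0 -mulr2n mulrn_eq0 /= => /eqP.
Qed.

Lemma antisym_sum_alternating v : v \in antisym_sum R N -> alternating v.
Proof.
have alt_lin (c : R[i]) v1 v2 :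
    alternating v1 -> alternating v2 -> alternating (c *: v1 + v2).
  move=> alt1 alt2 r t s; rewrite !ffunE alt1 alt2 mulrDr.
  by congr (_ + _); rewrite [LHS]mulrCA.
have alt0 : alternating 0 by move=> r t s; rewrite !ffunE mulr0.
have alt_sum (I : Type) (l : seq I) (P : pred I) (F : I -> tensor_space) :
    (forall i, P i -> alternating (F i)) -> alternating (\sum_(i <- l | P i) F i).
  move=> altF; apply: big_ind => // v1 v2; rewrite -{2}[v1]scale1r.
  exact: alt_lin.
case/memv_sumP => vs vs_in ->; apply: (alt_sum) => r _.
have := vs_in r isT => /coord_span->; apply: (alt_sum) => i _.
rewrite -[_ *: _]addr0; apply: alt_lin => //.
set X := [seq antisym_tensor R t | t <- enum (increasing N r)].
have /mapP[t] : X`_i \in X by apply: mem_nth; rewrite size_map -cardE.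
rewrite mem_enum => t_incr ->.
move=> r' t' s; rewrite !antisym_tensorE //= alt_sign_reorder weight_reorder.
by rewrite mulrA.
Qed.

Section Enumeration.
Variable h : cube N.

Definition cube_support : {set 'I_N} := [set x | h x != 0]%SET.

Lemma card_support_bound : (#|cube_support| < N.+1)%N.
Proof. by rewrite ltnS (leq_trans (max_card _)) ?card_ord. Qed.

Definition support_enum : multi_index N :=
  @MultiIndex N (Ordinal card_support_bound)
    [ffun x : 'I_#|cube_support| => enum_val x].

Lemma support_enum_increasing :
  tagged support_enum \in increasing N (tag support_enum).
Proof.
rewrite inE; apply/forallP => x; apply/forallP => y; apply/implyP => lt_xy.
have x0 : 'I_N := enum_val x.
rewrite !ffunE !(enum_val_nth x0).
apply: (sorted_ltn_nth (leT := relpre val ltn)) => //.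
- by move=> z1 z2 z3; exact: ltn_trans.
- apply: sorted_filter => [z1 z2 z3|]; first exact: ltn_trans.
  by rewrite -enumT -sorted_map val_enum_ord iota_ltn_sorted.
- by rewrite inE -cardE.
- by rewrite inE -cardE.
Qed.

Lemma weight_support_enum : weight (tagged support_enum) = h.
Proof.
apply/ffunP => y; rewrite weightE; last first.
  exact: increasing_inj support_enum_increasing.
have -> : (y \in codom (tagged support_enum)) = (h y != 0).
  apply/codomP/idP => [[x ->]|h_y].
    by rewrite ffunE; have := enum_valP x; rewrite inE.
  have y_h : y \in cube_support by rewrite inE.
  by exists (enum_rank_in y_h y); rewrite ffunE enum_rankK_in.
by case: (h y) => [[|[|]]] // ?; apply: val_inj.
Qed.

End Enumeration.

Definition wedge (h : cube N) : tensor_space :=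
  antisym_tensor R (tagged (support_enum h)).

Lemma wedgeE h q :
  wedge h q = alt_sign R (tagged q) * (weight (tagged q) == h)%:R.
Proof.
by rewrite antisym_tensorE ?weight_support_enum //; exact: support_enum_increasing.
Qed.

Lemma wedge_support_enum h h' : wedge h (support_enum h') = (h' == h)%:R.
Proof.
rewrite wedgeE weight_support_enum alt_sign_increasing ?mul1r //.
exact: support_enum_increasing.
Qed.

Lemma wedge_in_antisym_sum h : wedge h \in antisym_sum R N.
Proof.
rewrite /antisym_sum; set r := tag (support_enum h).
have le_r : (antisym_space R r <= \sum_(r < N.+1) antisym_space R r)%VS.
  exact: sumv_sup.
apply: (subvP le_r); apply/memv_span/mapP; exists (tagged (support_enum h)) => //.
by rewrite mem_enum support_enum_increasing.
Qed.

(** An alternating tensor is determined by its values at the increasing tuples,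
    and these are in bijection with the vertices of the cube. *)
Lemma alternating_wedge_sum v :
  alternating v -> v = \sum_h v (support_enum h) *: wedge h.
Proof.
move=> v_alt; apply/ffunP => q; rewrite sum_ffunE.
under eq_bigr do rewrite ffunE wedgeE.
have [q_inj|q_ninj] := boolP (injectiveb (tagged q)); last first.
  rewrite alternating_noninjective // big1 // => h _.
  by rewrite alt_sign_eq0 // mul0r scaler0.
set h := weight (tagged q); rewrite (bigD1 h) //= eqxx mulr1 big1 => [|h' neq_h'].
  have h_incr := support_enum_increasing h.
  have [|s ->] := @same_weight_reorder (support_enum h) q
      (increasing_inj h_incr) (injectiveP _ q_inj).
    exact: weight_support_enum.
  rewrite v_alt /= alt_sign_reorder alt_sign_increasing // mulr1 addr0.
  by rewrite [RHS]mulrC; congr (_ * v _); case: (support_enum h).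
by rewrite eq_sym (negPf neq_h') mulr0 scaler0.
Qed.

End AlternatingTensors.

(** * The action of the orthogonal group on antisymmetric tensors *)

Section Action.
Local Open Scope complex_scope.
Variables (R : realType) (N : nat).
Local Notation tensor_space := (tensor_space R N).
Implicit Types (g h : O_group R N) (v : tensor_space) (q : multi_index N).

Lemma alternating_in_antisym_sum v : alternating v -> v \in antisym_sum R N.
Proof.
move=> /alternating_wedge_sum->; apply: rpred_sum => h _.
exact/rpredZ/wedge_in_antisym_sum.
Qed.

Lemma tensor_action_linear g (c : R[i]) v1 v2 :
  tensor_action g (c *: v1 + v2) = c *: tensor_action g v1 + tensor_action g v2.
Proof.
apply/ffunP => q; rewrite !ffunE scaler_sumr -big_split.
by apply: eq_bigr => t _; rewrite !ffunE mulrDr; congr (_ + _); rewrite [LHS]mulrCA.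
Qed.

Lemma tensor_action_sum g (I : finType) (c : I -> R[i]) (v : I -> tensor_space) :
  tensor_action g (\sum_i c i *: v i) = \sum_i c i *: tensor_action g (v i).
Proof.
exact: (@linear_on_sum _ _ _ setT (tensor_action g) Logic.I
  (fun _ _ _ _ _ => Logic.I)
  (fun c v1 v2 _ _ => tensor_action_linear g c v1 v2)).
Qed.

Lemma tensor_action1 v : tensor_action (O_one R N) v = v.
Proof.
apply/ffunP => -[r t]; rewrite ffunE /= (bigD1 t) //= big1 => [|x _]; last first.
  by rewrite !mxE eqxx.
rewrite mul1r big1 ?addr0 // => t' neq_t'.
have [x neq_x] : exists x, t x != t' x.
  apply/existsP; apply: contra_neqT neq_t' => /existsPn eq_t'.
  by apply/ffunP => x; apply/eqP; rewrite eq_sym -[_ == _]negbK.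
by rewrite (bigD1 x) //= mxE (negPf neq_x) !mul0r.
Qed.

Lemma tensor_actionM g h v :
  tensor_action (O_mul g h) v = tensor_action g (tensor_action h v).
Proof.
apply/ffunP => -[r t]; rewrite !ffunE /=.
transitivity (\sum_(t' : {ffun 'I_r -> 'I_N}) \sum_(t'' : {ffun 'I_r -> 'I_N})
    (\prod_x (sval g (t x) (t'' x))%:C * \prod_x (sval h (t'' x) (t' x))%:C)
      * v (MultiIndex t')).
  apply: eq_bigr => t' _; rewrite -mulr_suml; congr (_ * _).
  under [RHS]eq_bigr do rewrite -big_split.
  rewrite -(bigA_distr_bigA (fun x y => (sval g (t x) y)%:C * (sval h y (t' x))%:C)).
  apply: eq_bigr => x _; rewrite mxE rmorph_sum; apply: eq_bigr => y _.
  by rewrite rmorphM.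
rewrite exchange_big /=; apply: eq_bigr => t'' _.
rewrite ffunE mulr_sumr; apply: eq_bigr => t' _.
by rewrite [RHS]mulrA.
Qed.

(** The action on a tensor power commutes with the permutations of the
    factors. *)
Lemma tensor_action_alternating g v :
  alternating v -> alternating (tensor_action g v).
Proof.
move=> v_alt r t s; rewrite !ffunE /= mulr_sumr.
rewrite (reindex _ (onW_bij _ (reorder_bij N s))) /=; apply: eq_bigr => t' _.
rewrite v_alt mulrCA; congr (_ * (_ * _)).
rewrite [RHS](reindex_inj (perm_inj (s := s))).
by apply: eq_bigr => x _; rewrite !ffunE.
Qed.

Lemma tensor_action_antisym g v :
  v \in antisym_sum R N -> tensor_action g v \in antisym_sum R N.
Proof.
move=> /antisym_sum_alternating v_alt; apply: alternating_in_antisym_sum.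
exact: tensor_action_alternating.
Qed.

Definition action_entry v q : O_group R N -> R[i]^o :=
  fun g => tensor_action g v q.

(** In this form the matrix entries of the action are visibly polynomials in the
    coordinates, and [theta] can be computed on them. *)
Lemma action_entryE v q :
  action_entry v q
    = \sum_(t : {ffun 'I_(tag q) -> 'I_N})
        v (MultiIndex t) *: \prod_x @coord_fun R N (tagged q x) (t x).
Proof.
apply/funext => g; rewrite /action_entry ffunE fct_sumE.
apply: eq_bigr => t _.
by rewrite mulrC fct_prodE.
Qed.

Let O_poly_subalgebra :=
  star_generated_subalgebra [set f | exists i j, f = @coord_fun R N i j]%classic.

Lemma O_poly_coord_prod (r : nat) (t j : 'I_r -> 'I_N) :
  O_poly (\prod_x @coord_fun R N (t x) (j x)).
Proof.
apply: (star_subalgebra_prod O_poly_subalgebra) => x B [_]; apply.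
by exists (t x), (j x).
Qed.

Lemma O_poly_sum (I : Type) (r : seq I) (P : pred I) (c : I -> R[i])
    (f : I -> O_group R N -> R[i]^o) :
  (forall i, O_poly (f i)) -> O_poly (\sum_(i <- r | P i) c i *: f i).
Proof.
have [_ O_lin _ _] := O_poly_subalgebra.
exact: (subspace_sum (star_subalgebra0 O_poly_subalgebra) O_lin).
Qed.

Lemma O_poly_action_entry v q : O_poly (action_entry v q).
Proof.
by rewrite action_entryE; apply: O_poly_sum => t; exact: O_poly_coord_prod.
Qed.

Section Basis.
Variables (n : nat) (b : n.-tuple tensor_space).
Hypothesis b_basis : basis_of (antisym_sum R N) b.


Lemma basis_nth_antisym (j : 'I_n) : b`_j \in antisym_sum R N.
Proof. by rewrite (basis_mem b_basis) // mem_nth ?size_tuple. Qed.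

Lemma coord_antisym i v :
  v \in antisym_sum R N ->
  coord b i v = \sum_h v (support_enum h) * coord b i (wedge R h).
Proof.
move=> /antisym_sum_alternating/alternating_wedge_sum {1}->.
by rewrite linear_sum; apply: eq_bigr => h _; rewrite linearZ.
Qed.

Lemma action_coeff_corep :
  @corepresentation R (O_coalgebra R N) _ (action_coeff b).
Proof.
have b_in := basis_nth_antisym.
have coeff_poly i j : O_poly (action_coeff b i j).
  have -> : action_coeff b i j
      = \sum_h coord b i (wedge R h) *: action_entry b`_j (support_enum h).
    apply/funext => g; rewrite fct_sumE.
    rewrite /action_coeff coord_antisym ?tensor_action_antisym //.
    by apply: eq_bigr => h _; rewrite mulrC.
  by apply: O_poly_sum => h; exact: O_poly_action_entry.
move=> i j; split; first exact: coeff_poly.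
  split=> [f /mapP[k _ ->] | g h]; first by split; exact: coeff_poly.
  rewrite big_map big_enum /= /action_coeff tensor_actionM.
  have /(coord_basis b_basis) {1}-> := tensor_action_antisym h (b_in j).
  rewrite tensor_action_sum linear_sum; apply: eq_bigr => k _.
  by rewrite linearZ mulrC.
rewrite /= /action_coeff tensor_action1 coord_free ?(basis_free b_basis) //.
by rewrite eq_sym.
Qed.

End Basis.

End Action.

(** * Fourier transform on the cube *)

Section Fourier.
Variables (R : realType) (N : nat) (B : starAlgType R).
Implicit Types (g h k : cube N) (x y : cube N -> B).

Lemma cube_sign0 k : (-1) ^+ cube_dot 0 k = 1 :> R[i].
Proof. by rewrite /cube_dot big1 // => z _; rewrite ffunE. Qed.

Lemma cube_signD g h k :
  (-1) ^+ cube_dot (g + h) k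
    = (-1) ^+ cube_dot g k * (-1) ^+ cube_dot h k :> R[i].
Proof.
rewrite /cube_dot !expr_sum -big_split; apply: eq_bigr => z _ /=; rewrite ffunE.
case: (g z) (h z) (k z) => [[|[|]]] // ? [[|[|]]] // ? [[|[|]]] // ?;
  by rewrite /= ?mulr1 ?mul1r ?mulrNN ?mulr1.
Qed.

Lemma fourier_point_mass (b : B) g k :
  fourier (point_mass b g) k = (-1) ^+ cube_dot g k *: b.
Proof.
rewrite /fourier (bigD1 g) //= /point_mass eqxx big1 ?addr0 // => h /negPf->.
by rewrite scaler0.
Qed.

Lemma fourier_sum (I : finType) (x : I -> cube N -> B) k :
  fourier (\sum_i x i) k = \sum_i fourier (x i) k.
Proof.
rewrite /fourier; under eq_bigr do rewrite fct_sumE scaler_sumr.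
by rewrite exchange_big.
Qed.

Lemma fourier_convolution x y k :
  fourier (convolution x y) k = fourier x k * fourier y k.
Proof.
rewrite /fourier /convolution; under eq_bigr do rewrite scaler_sumr.
rewrite exchange_big /= mulr_suml; apply: eq_bigr => h _.
rewrite (reindex_inj (addIr h)) mulr_sumr; apply: eq_bigr => g _.
by rewrite addrK cube_signD -scalerAl -scalerAr scalerA mulrC.
Qed.

Lemma point_massD g h :
  point_mass (1 : B) (g + h) = convolution (point_mass 1 g) (point_mass 1 h).
Proof.
apply/funext => k; rewrite /convolution /point_mass (bigD1 g) //= eqxx mul1r.
rewrite big1 => [|g' /negPf->]; last by rewrite mul0r.
by rewrite addr0 subr_eq addrC.
Qed.

End Fourier.

(** * The magic representation *)

Section Magic.
Variables (R : realType) (N : nat) (Q : obar R N).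
Variable Phi : (cube N -> R[i]^o) -> (cube N -> obar_alg Q).
Hypothesis Phi_coaction : hypercube_coaction Phi.

(** The matrix of the coaction in the basis of group elements. *)
Definition generator_rep (g h : cube N) : obar_alg Q := Phi (point_mass 1 g) h.

(** The coefficients of a product of elements sum_j ubar_ij (x) g_j of the group
    algebra. The Fourier transform turns the convolution into a pointwise
    product, where such a product of sums can be expanded. *)
Lemma generator_rep_weight (r : nat) (t : {ffun 'I_r -> 'I_N}) h :
  generator_rep (weight t) h
    = \sum_(j : {ffun 'I_r -> 'I_N} | weight j == h)
        \prod_x obar_u Q (t x) (j x).
Proof.
pose rhs h := \sum_(j : {ffun 'I_r -> 'I_N} | weight j == h)
  \prod_x obar_u Q (t x) (j x).
rewrite -/(rhs h); suff -> : generator_rep (weight t) = rhs by [].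
apply: (can_inj (@fourierK R N (obar_alg Q))); apply/funext => k.
pose chi g := fourier (generator_rep g) k.
have chi0 : chi 0 = 1.
  by rewrite /chi /generator_rep (coaction1 Phi_coaction) fourier_point_mass
    cube_sign0 scale1r.
have chiD g h' : chi (g + h') = chi g * chi h'.
  rewrite /chi /generator_rep point_massD (coactionM Phi_coaction).
  exact: fourier_convolution.
have chi_gen i :
    chi (cube_gen i) = \sum_j (-1) ^+ cube_dot (cube_gen j) k *: obar_u Q i j.
  rewrite /chi /generator_rep (coactionE Phi_coaction) fourier_sum.
  by apply: eq_bigr => j _; rewrite fourier_point_mass.
rewrite -/(chi (weight t)) /weight (big_morph chi chiD chi0).
under eq_bigr do rewrite chi_gen.
rewrite bigA_distr_bigA /= (partition_big (@weight N r) xpredT) //=.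
apply: eq_bigr => g _; rewrite scaler_sumr; apply: eq_bigr => j /eqP <-.
rewrite scaler_prod; congr (_ *: _).
rewrite /weight (big_morph (fun g => (-1) ^+ cube_dot g k : R[i])
  (fun g h => cube_signD R g h k) (cube_sign0 R k)).
by [].
Qed.

(** With F the matrix of characters, w = F^-1 phi F, as Psi is defined as the
    conjugate of Phi by the Fourier transform; the square of F is 2^N. *)
Lemma magic_generator_equiv :
  @corep_equiv R (obar_coalgebra Q) _ _ (magic_rep Phi) generator_rep.
Proof.
pose F (i k : cube N) : R[i] := (-1) ^+ cube_dot i k.
have two_neq0 : (2 ^+ N : R[i]) != 0 by rewrite expf_neq0 // pnatr_eq0.
have FC i k : F i k = F k i by rewrite /F cube_dotC.
have F_orth i i' : \sum_k F i k * F k i' = 2 ^+ N * (i == i')%:R.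
  have := congr1 (fun x => x i) (fourierK (point_mass (1 : R[i]^o) i')).
  rewrite /fourier_inv /point_mass => /(congr1 ( *%R (2 ^+ N))) /=.
  rewrite [X in X = _](mulVKf two_neq0) -/(point_mass 1 i').
  have -> : (if i == i' then 1 else 0 : R[i]^o) = (i == i')%:R by case: eqP.
  move=> <-; apply: eq_bigr => k _; rewrite fourier_point_mass [F k i']FC.
  by congr (_ * _); exact/esym/mulr1.
exists F, (fun k i => (2 ^+ N)^-1 * F k i); split=> [i i' | i i' | i h].
- under eq_bigr do rewrite mulrCA.
  by rewrite -mulr_sumr F_orth mulKf.
- under eq_bigr do rewrite -mulrA.
  by rewrite -mulr_sumr F_orth mulKf.
set x := fourier_inv (point_mass (1 : R[i]^o) i).
transitivity ((2 ^+ N : R[i]) *: Phi x h).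
  rewrite -[Phi x]fourierK /fourier_inv scalerA mulfV // scale1r.
  by apply: eq_bigr => k _; rewrite FC.
have xE : (2 ^+ N : R[i]) *: x = \sum_k F i k *: point_mass (1 : R[i]^o) k.
  apply/funext => k; rewrite fct_sumE (bigD1 k) //= big1 => [|k' neq_k'].
    rewrite addr0 /x /fourier_inv [LHS](mulVKf two_neq0).
    rewrite (bigD1 i) //= big1 => [|k' /negPf neq_k'].
      rewrite addr0 -/(F k i) FC; congr (_ * _).
      by rewrite /point_mass !eqxx.
    by rewrite /point_mass neq_k' scaler0.
  rewrite -[LHS]/(F i k' *: point_mass (1 : R[i]^o) k' k).
  by rewrite /point_mass eq_sym (negPf neq_k') scaler0.
have Phi_lin := coaction_linear Phi_coaction.
transitivity (Phi ((2 ^+ N : R[i]) *: x) h).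
  by rewrite (@linear_on_scale _ _ _ setT Phi _ _ (2 ^+ N) x) // => c y z _ _;
    exact: Phi_lin.
rewrite xE (@linear_on_sum _ _ _ setT Phi) // => [|c y z _ _]; last exact: Phi_lin.
by rewrite fct_sumE.
Qed.

Section Twist.
Variable theta : (O_group R N -> R[i]^o) -> obar_alg Q.
Hypothesis theta_twisting : twisting theta.

Let theta_linear := coiso_linear (twisting_iso theta_twisting).

Let O_poly0 : @O_poly R N 0.
Proof. exact: star_subalgebra0 (star_generated_subalgebra _). Qed.

Let theta_sum (I : Type) (r : seq I) (P : pred I) (c : I -> R[i])
    (f : I -> O_group R N -> R[i]^o) : (forall i, O_poly (f i)) ->
  theta (\sum_(i <- r | P i) c i *: f i)
    = \sum_(i <- r | P i) c i *: theta (f i).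
Proof.
have [_ O_lin _ _] := star_generated_subalgebra
  [set f | exists i j, f = @coord_fun R N i j]%classic.
exact: (linear_on_sum O_poly0 O_lin theta_linear).
Qed.

Let theta_scale (c : R[i]) (f : O_group R N -> R[i]^o) :
  O_poly f -> theta (c *: f) = c *: theta f.
Proof. exact: (linear_on_scale O_poly0 theta_linear). Qed.

Lemma theta_coord_prod (r : nat) (t j : {ffun 'I_r -> 'I_N}) :
  (tuple_twist R t * tuple_twist R j)
    *: theta (\prod_x @coord_fun R N (t x) (j x))
  = \prod_x obar_u Q (t x) (j x).
Proof.
rewrite -(twistingE theta_twisting) -theta_scale ?big_split //.
exact: O_poly_coord_prod.
Qed.

Lemma scale_coord_prodE (r : nat) (c : R[i]) (t j : 'I_r -> 'I_N)
    (g : O_group R N) :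
  (c *: \prod_x @coord_fun R N (t x) (j x)) g
    = c * \prod_x (@coord_fun R N (t x) (j x) g : R[i]).
Proof. by rewrite fct_prodE. Qed.

(** The preimage by [theta] of the entry of [phi] at (g_t, h), when g_t is written
    with its factors permuted by [s]. *)
Definition minor_sum (r : nat) (t : {ffun 'I_r -> 'I_N}) h (s : 'S_r) :=
  \sum_(j : {ffun 'I_r -> 'I_N} | weight j == h)
    (tuple_twist R (reorder t s) * tuple_twist R j)
      *: \prod_x @coord_fun R N (reorder t s x) (j x).

(** Summing over [s] makes the coefficient of each [j] a determinant, so that only
    injective [j] survive; for these the sign of the twist is [alt_sign j], the
    coefficient of the wedge. On the other side, reindexing the sum over [j] by
    each permutation and adding up the results gives the same determinants. *)
Lemma sum_minor_sum (r : 'I_N.+1) (t : {ffun 'I_r -> 'I_N}) h :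
  t \in increasing N r ->
  \sum_s minor_sum t h s
    = (r`!)%:R *: action_entry (wedge R h) (MultiIndex t).
Proof.
move=> t_incr; have t_inj := increasing_inj t_incr.
apply/funext => g; rewrite fct_sumE action_entryE.
pose M a c : R[i] := @coord_fun R N a c g.
transitivity (\sum_(j : {ffun 'I_r -> 'I_N} | weight j == h)
    alt_sign R j * \det (\matrix_(x, y) M (t x) (j y))).
  rewrite /minor_sum; under eq_bigr do rewrite fct_sumE.
  rewrite exchange_big /=; apply: eq_bigr => j _.
  transitivity (\sum_(s : 'S_r) pair_parity R r * tuple_twist R j *
      ((-1) ^+ s * \prod_x M (t (s x)) (j x))).
    apply: eq_bigr => s _; rewrite tuple_twistE; last first.
      by apply/injectiveP; rewrite reorder_inj; apply/injectiveP.
    rewrite alt_sign_reorder alt_sign_increasing // mulr1.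
    rewrite scale_coord_prodE (mulrAC (pair_parity R r)) -[LHS]mulrA.
    congr (_ * (_ * _)).
    by apply: eq_bigr => x _; rewrite /reorder ffunE.
  rewrite -mulr_sumr -[\det _]det_tr.
  have -> : \sum_(s : 'S_r) (-1) ^+ s * \prod_x M (t (s x)) (j x)
      = \det (\matrix_(x, y) M (t x) (j y))^T.
    rewrite /determinant; apply: eq_bigr => s _; congr (_ * _).
    by apply: eq_bigr => x _; rewrite !mxE.
  (* For injective j the two parities cancel. If j x = j y with x != y, the
     determinant has two equal rows. *)
  have [j_inj|j_ninj] := boolP (injectiveb j).
    by rewrite (tuple_twistE R (injectiveP _ j_inj)) mulrA pair_parityK mul1r.
  have [x [y neq_xy j_xy]] := injectivePn _ j_ninj.
  by rewrite (determinant_alternate neq_xy) ?mulr0 // => z; rewrite !mxE j_xy.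
set D := \sum_j _.
rewrite -[RHS]/((r`!)%:R * D g) mulr_natl {}/D fct_sumE.
transitivity (\sum_(s : 'S_r) \sum_(j : {ffun 'I_r -> 'I_N})
    alt_sign R j * (weight j == h)%:R * ((-1) ^+ s * \prod_x M (t x) (j (s x)))).
  rewrite exchange_big /= big_mkcond; apply: eq_bigr => j _.
  rewrite -mulr_sumr; case: eqP => _; rewrite ?mulr0 ?mul0r // mulr1.
  rewrite /determinant; congr (_ * _); apply: eq_bigr => s _; congr (_ * _).
  by apply: eq_bigr => x _; rewrite !mxE.
rewrite -card_Sn -sumr_const; apply: eq_big => [s|s _]; first by rewrite inE.
rewrite [RHS](reindex _ (onW_bij _ (reorder_bij N s))); apply: eq_bigr => j _ /=.
rewrite wedgeE /= weight_reorder alt_sign_reorder scale_coord_prodE.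
rewrite mulrCA !mulrA; congr (_ * _).
by apply: eq_bigr => x _; rewrite ffunE.
Qed.

(** All the terms of [sum_minor_sum] have the same image by [theta], because the
    cube is commutative; divide by r!. *)
Lemma generator_rep_wedge h k :
  generator_rep h k = theta (action_entry (wedge R k) (support_enum h)).
Proof.
set p := support_enum h; pose r := tag p; pose t := tagged p.
have t_incr : t \in increasing N r := support_enum_increasing h.
have minorP s : O_poly (minor_sum t k s).
  by apply: O_poly_sum => j; exact: O_poly_coord_prod.
have theta_minor s : theta (minor_sum t k s) = generator_rep h k.
  rewrite theta_sum => [|j]; last exact: O_poly_coord_prod.
  under eq_bigr do rewrite theta_coord_prod.
  by rewrite -generator_rep_weight weight_reorder weight_support_enum.
have fact_neq0 : (r`!)%:R != 0 :> R[i] by rewrite pnatr_eq0 -lt0n fact_gt0.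
apply: (scalerI fact_neq0); rewrite -theta_scale; last exact: O_poly_action_entry.
have -> : action_entry (wedge R k) p = action_entry (wedge R k) (MultiIndex t).
  by rewrite /t; case: (p).
rewrite -sum_minor_sum //.
under [in RHS]eq_bigr do rewrite -[minor_sum _ _ _]scale1r.
rewrite theta_sum //; under eq_bigr do rewrite theta_minor scale1r.
by rewrite sumr_const scaler_nat card_Sn.
Qed.

(** The change of basis between [b] and the wedges. *)
Lemma generator_action_equiv (n : nat) (b : n.-tuple (tensor_space R N)) :
  basis_of (antisym_sum R N) b ->
  @corep_equiv R (obar_coalgebra Q) _ _ generator_rep
    (fun i j => theta (action_coeff b i j)).
Proof.
move=> b_basis.
have b_in := basis_nth_antisym b_basis.
have coeff_poly i j : O_poly (action_coeff b i j).
  by have [] := action_coeff_corep b_basis i j.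
(* The matrix of b in the basis of wedges, and its inverse. *)
exists (fun h (i : 'I_n) => b`_i (support_enum h)),
  (fun i h => coord b i (wedge R h)).
split=> [h h' | i i' | h j].
- rewrite -(wedge_support_enum R).
  rewrite {2}(coord_basis b_basis (wedge_in_antisym_sum R h')) sum_ffunE.
  by apply: eq_bigr => i _; rewrite ffunE mulrC.
- rewrite eq_sym -(coord_free _ _ (basis_free b_basis)) coord_antisym //.
  by apply: eq_bigr => h _; rewrite mulrC.
under eq_bigr do rewrite generator_rep_wedge.
rewrite -!theta_sum // => [|k]; last exact: O_poly_action_entry.
congr theta; apply/funext => g; rewrite !fct_sumE.
transitivity (tensor_action g b`_j (support_enum h)).
  rewrite {2}(alternating_wedge_sum (antisym_sum_alternating (b_in j))).
  by rewrite tensor_action_sum sum_ffunE; apply: eq_bigr => k _; rewrite ffunE.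
rewrite {1}(coord_basis b_basis (tensor_action_antisym g (b_in j))) sum_ffunE.
by apply: eq_bigr => k _; rewrite ffunE; exact: mulrC.
Qed.

End Twist.

End Magic.

Theorem theorem4p3 (R : realType) (N : nat) (N_ge1 : (1 <= N)%N)
  (Q : obar R N)
  (Phi : (cube N -> R[i]^o) -> (cube N -> obar_alg Q))
  (Phi_coaction : hypercube_coaction Phi)
  (theta : (O_group R N -> R[i]^o) -> obar_alg Q)
  (theta_twisting : twisting theta)
  (n : nat) (b : n.-tuple (tensor_space R N))
  (b_basis : basis_of (antisym_sum R N) b) :
  @corresponds R (O_coalgebra R N) (obar_coalgebra Q) theta
    _ _ (action_coeff b) (magic_rep Phi).
Proof.
have action_corep := action_coeff_corep b_basis.
have magic_action := corep_equiv_trans (magic_generator_equiv Phi_coaction)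
  (generator_action_equiv Phi_coaction theta_twisting b_basis).
split=> //; apply: obar_corep_equiv magic_action _.
exact: coalgebra_iso_corep (twisting_iso theta_twisting) action_corep.
Qed.
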